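(* Let $F:\mathbb{R}^d\to\mathbb{R}$ be Lipschitz-smooth with constant $L>0$, let $c\in(0,1)$ and $0<\epsilon<\rho<1$, and suppose the directions $d_k$ at the points $x_k$ are descent directions that are gradient related with constants $c_1,c_2>0$. Given an initial step-size $\alpha_0>0$, both regular backtracking (BLS) and adaptive backtracking (ABLS), called at $(x_k,d_k)$, return a step-size $\alpha_k$ such that $$\alpha_k\ \ge\ \min\Bigl\{\alpha_0,\ \rho\,\frac{2(1-c)c_1}{Lc_2^2}\Bigr\}\ >\ 0 .$$
   Context: A differentiable $F$ is Lipschitz-smooth with constant $L>0$ if $F(y)\le F(x)+\langle\nabla F(x),y-x\rangle+\frac L2\|y-x\|^2$ for all $x,y$. Directions $d_k$ at points $x_k$ are gradient related with constants $c_1,c_2>0$ if $\langle\nabla F(x_k),-d_k\rangle\ge c_1\|\nabla F(x_k)\|^2$ and $\|d_k\|\le c_2\|\nabla F(x_k)\|$ for all $k$; they are descent directions if $\langle\nabla F(x_k),d_k\rangle<0$. The Armijo condition at $(x_k,d_k)$ for $\alpha>0$ is $F(x_k+\alpha d_k)-F(x_k)\le c\,\alpha\langle\nabla F(x_k),d_k\rangle$, equivalently $v(\alpha)\ge1$ where $$v(\alpha)=\frac{F(x_k+\alpha d_k)-F(x_k)}{c\,\alpha\langle\nabla F(x_k),d_k\rangle}.$$ BLS: set $\alpha\gets\alpha_0$; while $v(\alpha)<1$, set $\alpha\gets\rho\alpha$; return $\alpha$. ABLS: set $\alpha\gets\alpha_0$; while $v(\alpha)<1$, set $\alpha\gets\hat\rho(v(\alpha))\alpha$,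 where $\hat\rho(v(\alpha))=\max\bigl(\epsilon,\rho\frac{1-c}{1-c\,v(\alpha)}\bigr)$; return $\alpha$. *)

(* Defs.v *)
(* MathComp-Analysis, over an arbitrary real type R. *)
From HB Require Import structures.
From mathcomp Require Import all_boot all_order all_algebra.
From mathcomp Require Import all_classical all_reals all_analysis.

Set Implicit Arguments.
Unset Strict Implicit.
Unset Printing Implicit Defensive.

Import Order.TTheory GRing.Theory Num.Theory.
Import numFieldNormedType.Exports.

Local Open Scope ring_scope.

Section Definitions.
Variables (R : realType) (d : nat).
Implicit Types (F : 'rV[R]_d -> R) (x u w : 'rV[R]_d).

Definition dotp u w : R := \sum_(i < d) u 0 i * w 0 i.

(* The library norm `|u| on 'rV[R]_d is the sup norm, so the Euclidean norm is
   introduced separately; both induce the topology used by [differentiable]. *)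
Definition enorm u : R := Num.sqrt (dotp u u).

Definition grad F x : 'rV[R]_d := \row_(i < d) 'D_(delta_mx 0 i) F x.

Definition lipschitz_smooth F (L : R) : Prop :=
  (forall x, differentiable F x) /\
  (forall x y,
     F y <= F x + dotp (grad F x) (y - x) + L / 2 * enorm (y - x) ^+ 2).

Definition descent_directions F (x_ d_ : nat -> 'rV[R]_d) : Prop :=
  forall k, dotp (grad F (x_ k)) (d_ k) < 0.

Definition gradient_related F (x_ d_ : nat -> 'rV[R]_d) (c1 c2 : R) : Prop :=
  forall k,
    dotp (grad F (x_ k)) (- d_ k) >= c1 * enorm (grad F (x_ k)) ^+ 2 /\
    enorm (d_ k) <= c2 * enorm (grad F (x_ k)).

(* For a descent direction w and a > 0, the Armijo condition at a reads
   1 <= armijo_ratio F c x w a. *)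
Definition armijo_ratio F (c : R) x w (a : R) : R :=
  (F (x + a *: w) - F x) / (c * a * dotp (grad F x) w).

End Definitions.

Section Backtracking.
Variable R : realType.

(* Big-step semantics of "while v(a) < 1, set a <- r(v(a)) a; return a":
   [backtrack v r a b] says that the loop entered with step-size a terminates
   and returns b. *)
Inductive backtrack (v r : R -> R) : R -> R -> Prop :=
| backtrack_stop a : 1 <= v a -> backtrack v r a a
| backtrack_step a b :
    v a < 1 -> backtrack v r (r (v a) * a) b -> backtrack v r a b.

Lemma backtrack_unique (v r : R -> R) (a b b' : R) :
  backtrack v r a b -> backtrack v r a b' -> b = b'.
Proof.
move=> H; elim: H b' => {a b} [a va | a b va _ IH] b' H'.
  by case: H' va => // {b'} a' b' va' _; rewrite leNgt va'.
by case: H' va IH => [a' va' | a' {}b' _ Hb' _ IH]; [rewrite ltNge va' | exact: IH].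
Qed.

Definition adaptive_factor (c rho eps v : R) : R :=
  Num.max eps (rho * ((1 - c) / (1 - c * v))).

Variable d : nat.
Implicit Types (F : 'rV[R]_d -> R) (x w : 'rV[R]_d).

Definition BLS F (c rho : R) x w (alpha0 alpha : R) : Prop :=
  backtrack (armijo_ratio F c x w) (fun=> rho) alpha0 alpha.

Definition ABLS F (c rho eps : R) x w (alpha0 alpha : R) : Prop :=
  backtrack (armijo_ratio F c x w) (adaptive_factor c rho eps) alpha0 alpha.

End Backtracking.

(* Main.v *)
(* Smoothness and gradient relatedness give [1 - c v(a) <= a / M] for
   [M = 2 c1 / (L c2^2)].  When the Armijo test fails, [1 - c v(a) > 1 - c],
   hence [a > (1 - c) M], and both the regular and the adaptive update keep the
   next step-size between [rho (1 - c) M] and [rho a].  The upper bound forces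
   termination, the lower bound is the claim. *)
Require Import Defs.
From HB Require Import structures.
From mathcomp Require Import all_boot all_order all_algebra.
From mathcomp Require Import all_classical all_reals all_analysis.
From mathcomp Require Import ring lra.

Import Order.TTheory GRing.Theory Num.Theory.
Import numFieldNormedType.Exports.

Local Open Scope ring_scope.

Lemma exists_expr_mul_le (R : realType) (q a m : R) :
  0 <= q -> q < 1 -> 0 < a -> 0 < m -> exists n, q ^+ n * a <= m.
Proof.
move=> q0 q1 a0 m0.
have q_cvg : (GRing.exp q @ \oo --> (0 : R))%classic
  by apply: cvg_expr; rewrite ger0_norm.
have e0 : 0 < m / a by rewrite divr_gt0.
have [n _ nP] := (cvgr0Pnorm_le _).1 q_cvg _ e0.
exists n; rewrite -ler_pdivlMr//.
by have := nP n (leqnn n); rewrite ger0_norm// exprn_ge0.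
Qed.

(** A rejected step-size exceeds [m], while every update shrinks it at least by the factor [q]. So
    any [n] with [q ^+ n * a <= m] bounds the number of updates, and induction on [n] builds the
    run. *)
Lemma backtrack_lower_bound (R : realType) (v r : R -> R) (q m : R) :
  0 < q -> q < 1 -> 0 < m ->
  (forall a, 0 < a -> v a < 1 -> m < a /\ q * m <= r (v a) * a <= q * a) ->
  forall a, 0 < a -> exists b, backtrack v r a b /\ Num.min a (q * m) <= b.
Proof.
move=> q0 q1 m0 vr a a0.
have [n] := @exists_expr_mul_le R q a m (ltW q0) q1 a0 m0.
elim: n a a0 => [|n IHn] a a0 an; have [va|va] := leP 1 (v a);
  try by exists a; split; [exact: backtrack_stop | rewrite ge_min lexx].
  (* With no updates left, [a <= m], so the test cannot fail. *)
  by have [+ _] := vr a a0 va; rewrite ltNge -(mul1r a) an.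
have [_ /andP[lo hi]] := vr a a0 va.
have ra0 : 0 < r (v a) * a by apply: lt_le_trans lo; rewrite mulr_gt0.
have [|b [rb mb]] := IHn _ ra0.
  apply: le_trans an; rewrite exprSr -mulrA.
  by rewrite ler_wpM2l// exprn_ge0// ltW.
exists b; split; first exact: backtrack_step.
(* The next step-size is at least [q * m], so the minimum in the induction hypothesis collapses to
   [q * m]. *)
apply: le_trans mb; rewrite [X in _ <= X]min_r//.
by rewrite ge_min lexx orbT.
Qed.

Lemma dotpZr (R : realType) (d : nat) (a : R) (u w : 'rV[R]_d) :
  dotp u (a *: w) = a * dotp u w.
Proof.
by rewrite /dotp mulr_sumr; apply: eq_bigr => i _; rewrite mxE mulrCA.
Qed.

Lemma dotpNr (R : realType) (d : nat) (u w : 'rV[R]_d) :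
  dotp u (- w) = - dotp u w.
Proof. by rewrite -scaleN1r dotpZr mulN1r. Qed.

Lemma enorm_sqr (R : realType) (d : nat) (u : 'rV[R]_d) :
  enorm u ^+ 2 = dotp u u.
Proof.
by rewrite sqr_sqrtr// sumr_ge0// => i _; rewrite -expr2 sqr_ge0.
Qed.

Lemma enormZ_sqr (R : realType) (d : nat) (a : R) (u : 'rV[R]_d) :
  enorm (a *: u) ^+ 2 = a ^+ 2 * enorm u ^+ 2.
Proof.
rewrite !enorm_sqr /dotp mulr_sumr; apply: eq_bigr => i _.
by rewrite !mxE; ring.
Qed.

(** The factor [c] cancels: with slope g < 0, 1 - c v(a) is the gap F(x + a w) - F(x) - a g divided
    by - a g. Smoothness bounds the gap by (L / 2) a^2 |w|^2. *)
Lemma armijo_ratio_bound (R : realType) (d : nat) (F : 'rV[R]_d -> R)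
    (L c c1 c2 a : R) (x w : 'rV[R]_d) :
  0 < L -> lipschitz_smooth F L -> 0 < c -> 0 < c1 -> 0 < c2 ->
  dotp (grad F x) w < 0 ->
  c1 * enorm (grad F x) ^+ 2 <= dotp (grad F x) (- w) ->
  enorm w <= c2 * enorm (grad F x) -> 0 < a ->
  (1 - c * armijo_ratio F c x w a) * (2 * c1 / (L * c2 ^+ 2)) <= a.
Proof.
move=> L0 [_ F_le] c0 c10 c20 g0 g1 w2 a0; rewrite dotpNr in g1.
have := F_le x (x + a *: w).
rewrite [x + _]addrC addrK dotpZr enormZ_sqr addrC /armijo_ratio.
move: g0 g1 w2.
set g := dotp _ _; set G := enorm (grad F x); set D := enorm w.
set Fa := F _; set Fx := F x => g0 g1 w2 FaFx.
have D2 : D ^+ 2 <= c2 ^+ 2 * G ^+ 2.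
  by rewrite -exprMn ler_sqr// nnegrE ?mulr_ge0// ?sqrtr_ge0// ltW.
(* Eliminating the gradient norm between the two conditions of gradient relatedness bounds |w|^2 by
   a multiple of the slope, which then cancels. *)
have D2g : c1 * D ^+ 2 <= c2 ^+ 2 * - g.
  apply: (@le_trans _ _ (c2 ^+ 2 * (c1 * G ^+ 2))).
    by rewrite [leRHS]mulrCA ler_wpM2l// ltW.
  by rewrite ler_wpM2l// sqr_ge0.
have gn : g != 0 by rewrite lt_eqF.
have K0 : 0 < L * c2 ^+ 2 by rewrite mulr_gt0// exprn_gt0.
rewrite [leLHS]mulrA ler_pdivrMr//.
have -> : 1 - c * ((Fa - Fx) / (c * a * g)) = (a * - g + (Fa - Fx)) / (a * - g).
  by field; rewrite gn !gt_eqF.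
have ag0 : 0 < a * - g by rewrite mulr_gt0// oppr_gt0.
rewrite [leLHS]mulrAC ler_pdivrMr//.
apply: (@le_trans _ _ (L / 2 * (a ^+ 2 * D ^+ 2) * (2 * c1))).
  by rewrite ler_wpM2r ?mulr_ge0 ?(ltW c10)//; lra.
have -> : L / 2 * (a ^+ 2 * D ^+ 2) * (2 * c1) = L * a ^+ 2 * (c1 * D ^+ 2).
  by field.
have -> : a * (L * c2 ^+ 2) * (a * - g) = L * a ^+ 2 * (c2 ^+ 2 * - g) by ring.
by rewrite ler_wpM2l// mulr_ge0 ?sqr_ge0// ltW.
Qed.

Theorem proposition9 (R : realType) (d : nat) (F : 'rV[R]_d -> R)
    (L c rho eps c1 c2 alpha0 : R) (x_ d_ : nat -> 'rV[R]_d)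
    (L_gt0 : 0 < L) (F_smooth : lipschitz_smooth F L)
    (c_gt0 : 0 < c) (c_lt1 : c < 1)
    (eps_gt0 : 0 < eps) (eps_lt_rho : eps < rho) (rho_lt1 : rho < 1)
    (c1_gt0 : 0 < c1) (c2_gt0 : 0 < c2)
    (d_descent : descent_directions F x_ d_)
    (d_related : gradient_related F x_ d_ c1 c2)
    (alpha0_gt0 : 0 < alpha0) :
  let lower := Num.min alpha0 (rho * (2 * (1 - c) * c1 / (L * c2 ^+ 2))) in
  0 < lower /\
  forall k : nat,
    (exists alpha, BLS F c rho (x_ k) (d_ k) alpha0 alpha /\ lower <= alpha) /\
    (exists alpha, ABLS F c rho eps (x_ k) (d_ k) alpha0 alpha /\
                   lower <= alpha).
Proof.
have rho_gt0 : 0 < rho by exact: lt_trans eps_lt_rho.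
have c'_gt0 : 0 < 1 - c by rewrite subr_gt0.
set M := 2 * c1 / (L * c2 ^+ 2).
have M_gt0 : 0 < M by rewrite divr_gt0 ?mulr_gt0 ?exprn_gt0.
have -> : 2 * (1 - c) * c1 / (L * c2 ^+ 2) = (1 - c) * M.
  by rewrite /M; ring.
have m_gt0 : 0 < (1 - c) * M by rewrite mulr_gt0.
split; first by rewrite lt_min alpha0_gt0 mulr_gt0.
move=> k; have [g1 w2] := d_related k.
have vM a : 0 < a -> (1 - c * armijo_ratio F c (x_ k) (d_ k) a) * M <= a.
  exact: armijo_ratio_bound.
have fail_gt a : 0 < a -> armijo_ratio F c (x_ k) (d_ k) a < 1 ->
    1 - c < 1 - c * armijo_ratio F c (x_ k) (d_ k) a /\ (1 - c) * M < a.
  move=> a0 va; have lt_c : 1 - c < 1 - c * armijo_ratio F c (x_ k) (d_ k) a.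
    by rewrite ltrD2l ltrN2 gtr_pMr.
  by split=> //; apply: lt_le_trans (vM a a0); rewrite ltr_pM2r.
(* Both loops are instances with [q := rho] and [m := (1 - c) * M]. *)
split; apply: backtrack_lower_bound => // a a0 va;
  have [lt_c m_lt] := fail_gt a a0 va; split=> //.
  by rewrite lexx ler_wpM2l// ltW.
have cv_gt0 := lt_trans c'_gt0 lt_c.
apply/andP; split; rewrite /adaptive_factor.
  (* The second argument of the maximum suffices here: [vM] says exactly that a / (1 - c v(a)) is at
     least [M]. *)
  apply: (@le_trans _ _ (rho * ((1 - c) / (1 - c * armijo_ratio F c (x_ k) (d_ k) a)) * a)).
    rewrite -mulrA ler_pM2l// -mulrA ler_pM2l//.
    by rewrite mulrC ler_pdivlMr// mulrC vM.
  by rewrite ler_wpM2r ?(ltW a0)// le_max lexx orbT.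
(* Both arguments of the maximum are at most [rho]: the first by [eps < rho], the second because (1
   - c) / (1 - c v(a)) < 1 after a failed test. *)
rewrite ler_wpM2r ?(ltW a0)// ge_max (ltW eps_lt_rho)/=.
by rewrite ger_pMr// ler_pdivrMr// mul1r ltW.
Qed.
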